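(* Let $(M,g)$ be a Riemannian manifold. (Hessian version) Suppose that $M$ admits a $C^2$ function $\phi:M\to\mathbb{R}$ satisfying, for some constants $C,D>0$: (i) $\phi$ is proper; (ii) $|\nabla\phi|\le C$ on $M$; (iii) $\mathrm{Hess}\,\phi\le D g$ on $M$. Then for every $f\in C^2(M)$ that is bounded above there exists a sequence $(q_k)_{k\in\mathbb{N}}$ in $M$ such that, for all $k\in\mathbb{N}$ ($k\ge 1$), $$f(q_k)>\sup_M f-\frac1k,\qquad |\nabla f|(q_k)<\frac1k,\qquad \mathrm{Hess} f(q_k)<\frac1k\,g(q_k).$$ (Laplacian version) Suppose that $M$ admits a $C^2$ function $\phi:M\to\mathbb{R}$ satisfying, for some constants $C,D>0$: (i) $\phi$ is proper; (ii) $|\nabla\phi|\le C$ on $M$; (iii) $\Delta\phi\le D$ on $M$. Then for every $f\in C^2(M)$ that is bounded above there exists a sequence $(q_k)_{k\in\mathbb{N}}$ in $M$ such that, for all $k\in\mathbb{N}$ ($k\ge 1$), $$f(q_k)>\sup_M f-\frac1k,\qquad |\nabla f|(q_k)<\frac1k,\qquad \Delta f(q_k)<\frac1k.$$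
   Context: A function $\phi:M\to\mathbb{R}$ is called proper if $\phi(x)\to+\infty$ as $x\to\infty$, i.e. for every $R\in\mathbb{R}$ there is a compact set $K_R\subset M$ with $\phi>R$ on $M\setminus K_R$. Here $\nabla$, $\mathrm{Hess}$ and $\Delta=\mathrm{tr}_g\mathrm{Hess}$ are the gradient, Hessian and Laplacian of $(M,g)$. Inequalities involving Hessians are in the sense of quadratic forms: $\mathrm{Hess}\,\phi\le Dg$ means $\mathrm{Hess}\,\phi(x)(v,v)\le D|v|^2$ for all $x\in M$ and $v\in T_xM$; $\mathrm{Hess} f(q)<\frac1k g(q)$ means $\mathrm{Hess} f(q)(v,v)<\frac1k|v|^2$ for all $v\in T_qM$, $v\ne0$. Completeness of $M$ is not assumed. *)

(* Defs.v *)
From mathcomp Require Import all_boot all_order all_algebra.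
From mathcomp Require Import all_classical all_reals all_analysis.

Set Implicit Arguments.
Unset Strict Implicit.
Unset Printing Implicit Defensive.

Import Order.TTheory GRing.Theory Num.Theory.
Import numFieldNormedType.Exports.

Local Open Scope classical_set_scope.
Local Open Scope ring_scope.

(** * Functions of class C^k on an open set *)

(* For finite-dimensional [V] and open [U] this is the usual notion: asking for
   all directional derivatives amounts to asking for the partial ones. *)
Fixpoint Ck_on (R : realType) (V W : normedModType R) (k : nat) (U : set V)
    (f : V -> W) : Prop :=
  if k is k'.+1 then
    (forall x, U x -> differentiable f x) /\
    (forall v, Ck_on k' U (fun x => 'D_v f x))
  else forall x, U x -> {for x, continuous f}.

Definition smooth_on (R : realType) (V W : normedModType R) (U : set V)
    (f : V -> W) : Prop := forall k, Ck_on k U f.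

(** * Smooth manifolds *)

(* [chart_fun] and [chart_inv] are total functions; only their restrictions to
   [chart_dom] and [chart_cod], which are inverse homeomorphisms, matter. *)
Record chart (R : realType) (n : nat) (T : topologicalType) := Chart {
  chart_dom : set T;
  chart_cod : set 'rV[R]_n;
  chart_fun : T -> 'rV[R]_n;
  chart_inv : 'rV[R]_n -> T;
  chart_dom_open : open chart_dom;
  chart_cod_open : open chart_cod;
  chart_funP : forall p, chart_dom p -> chart_cod (chart_fun p);
  chart_invP : forall x, chart_cod x -> chart_dom (chart_inv x);
  chart_funK : forall p, chart_dom p -> chart_inv (chart_fun p) = p;
  chart_invK : forall x, chart_cod x -> chart_fun (chart_inv x) = x;
  chart_fun_cts : forall p, chart_dom p -> {for p, continuous chart_fun};
  chart_inv_cts : forall x, chart_cod x -> {for x, continuous chart_inv}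
}.

(* The overlap of the domains of [c] and [c'], read in the coordinates of [c];
   the transition map [chart_fun c' \o chart_inv c] lives there. *)
Definition overlap (R : realType) (n : nat) (T : topologicalType)
    (c c' : chart R n T) : set 'rV[R]_n :=
  [set x | chart_cod c x /\ chart_dom c' (chart_inv c x)].

Record smoothManifold (R : realType) (n : nat) := SmoothManifold {
  mfd_space :> topologicalType;
  mfd_nonempty : [set: mfd_space] !=set0;
  mfd_hausdorff : hausdorff_space mfd_space;
  mfd_second_countable : @second_countable mfd_space;
  mfd_index : Type;
  mfd_chart : mfd_index -> chart R n mfd_space;
  mfd_cover : forall p, exists i, chart_dom (mfd_chart i) p;
  mfd_transition : forall i j,
    smooth_on (overlap (mfd_chart i) (mfd_chart j))
      (chart_fun (mfd_chart j) \o chart_inv (mfd_chart i))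
}.

Section Functions.
Context {R : realType} {n : nat} (M : smoothManifold R n).

Definition in_chart (f : M -> R) (i : mfd_index M) : 'rV[R]_n -> R :=
  f \o chart_inv (mfd_chart i).

Definition C2_mfd (f : M -> R) : Prop :=
  forall i, Ck_on 2 (chart_cod (mfd_chart i)) (in_chart f i).

Definition proper_fun (f : M -> R) : Prop :=
  forall r : R, exists K : set M, compact K /\ forall x, ~ K x -> r < f x.

Definition chart_at (p : M) : mfd_index M := sval (cid (mfd_cover p)).

Definition coord_at (p : M) : 'rV[R]_n := chart_fun (mfd_chart (chart_at p)) p.

(* A tangent vector at [p] is given by its components with respect to the
   coordinate basis of the chart [chart_at p]. *)
Definition tangent (p : M) : Type := 'rV[R]_n.

End Functions.

(** * Riemannian metrics *)

Definition bilin (R : realType) (n : nat) (B : 'M[R]_n) (v w : 'rV[R]_n) : R :=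
  (v *m B *m w^T) 0 0.

(* [gram i x] is the matrix of the metric in the coordinate basis of the i-th
   chart, at the point with coordinates [x].  The field [gram_transition] is the
   transformation law of a (0,2)-tensor, a change of coordinates acting on the
   components of tangent vectors by its derivative. *)
Record riemannianMetric (R : realType) (n : nat) (M : smoothManifold R n) :=
    RiemannianMetric {
  gram : mfd_index M -> 'rV[R]_n -> 'M[R]_n;
  gram_smooth : forall i, smooth_on (chart_cod (mfd_chart i)) (gram i);
  gram_sym : forall i x, chart_cod (mfd_chart i) x -> (gram i x)^T = gram i x;
  gram_posdef : forall i x, chart_cod (mfd_chart i) x ->
    forall v, v != 0 -> 0 < bilin (gram i x) v v;
  gram_transition : forall i j x, overlap (mfd_chart i) (mfd_chart j) x ->
    let tau := chart_fun (mfd_chart j) \o chart_inv (mfd_chart i) in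
    forall v w, bilin (gram i x) v w =
      bilin (gram j (tau x)) ('D_v tau x) ('D_w tau x)
}.

(** * Differential calculus in coordinates *)

Section Coordinates.
Context {R : realType} {n : nat}.

Definition partial (a : 'I_n) (h : 'rV[R]_n -> R) (x : 'rV[R]_n) : R :=
  'D_(delta_mx 0 a) h x.

Definition dform (h : 'rV[R]_n -> R) (x : 'rV[R]_n) : 'rV[R]_n :=
  \row_a partial a h x.

(* Gamma^c_{ab} for the Levi-Civita connection of the metric [G]. *)
Definition christoffel (G : 'rV[R]_n -> 'M[R]_n) (x : 'rV[R]_n)
    (c a b : 'I_n) : R :=
  2^-1 * \sum_(d < n) invmx (G x) c d *
    (partial a (fun y => G y b d) x + partial b (fun y => G y a d) x
     - partial d (fun y => G y a b) x).

(* Covariant derivative of a 1-form: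
   (nabla_a w)_b = d_a w_b - Gamma^c_{ab} w_c. *)
Definition covder (G : 'rV[R]_n -> 'M[R]_n) (w : 'rV[R]_n -> 'rV[R]_n)
    (x : 'rV[R]_n) : 'M[R]_n :=
  \matrix_(a, b) (partial a (fun y => w y 0 b) x
                  - \sum_(c < n) christoffel G x c a b * w x 0 c).

End Coordinates.

(** * Gradient, Hessian and Laplacian *)

(* The tensors below are computed in the chart [chart_at p].  For [f] of class
   C^2, [norm_grad] and [laplacian] do not depend on that chart, and neither do
   [inner] and [hess] as bilinear forms on the tangent space, thanks to
   [gram_transition]. *)
Section Riemannian.
Context {R : realType} {n : nat} {M : smoothManifold R n}.
Variable g : riemannianMetric M.

Definition gram_at (p : M) : 'M[R]_n := gram g (chart_at p) (coord_at p).

Definition inner (p : M) (v w : tangent p) : R := bilin (gram_at p) v w.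

Definition grad (f : M -> R) (p : M) : tangent p :=
  dform (in_chart f (chart_at p)) (coord_at p) *m invmx (gram_at p).

Definition norm_grad (f : M -> R) (p : M) : R :=
  Num.sqrt (inner (grad f p) (grad f p)).

(* The Hessian is the covariant derivative of the differential. *)
Definition hess_mx (f : M -> R) (p : M) : 'M[R]_n :=
  covder (gram g (chart_at p)) (dform (in_chart f (chart_at p))) (coord_at p).

Definition hess (f : M -> R) (p : M) (v w : tangent p) : R :=
  bilin (hess_mx f p) v w.

(* The trace with respect to the metric, g^{ab} Hess_{ab}. *)
Definition laplacian (f : M -> R) (p : M) : R :=
  \tr (invmx (gram_at p) *m hess_mx f p).

End Riemannian.

(* Main.v *)
Require Import Defs.
From mathcomp Require Import all_boot all_order all_algebra.
From mathcomp Require Import all_classical all_reals all_analysis.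
From mathcomp Require Import lra.
Set Implicit Arguments.
Unset Strict Implicit.
Unset Printing Implicit Defensive.
Import Order.TTheory GRing.Theory Num.Theory.
Import numFieldNormedType.Exports.
Local Open Scope classical_set_scope.
Local Open Scope ring_scope.

(** The idea is to perturb [f] by a small multiple of [phi].  Since [phi] is
    proper and [f] is bounded above, the function [f - e * phi] has a maximum
    point [q] for every [e > 0] ([max_sub_proper]), and [f q] is as close to the
    supremum of [f] as desired when [e] is small ([almost_max]).

    In the chart at [q], the first derivatives of [f - e * phi] vanish and its
    second derivative in each direction is nonpositive
    ([second_derivative_test_max_dir]).  The Christoffel symbols enter the
    Hessian only through a term linear in the differential ([covder_dform]),
    and the differentials of [f] and [e * phi] agree at [q], so this term
    cancels and the Hessian of [f] at [q] is at most [e] times that of [phi]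
    ([covder_le_at_max], [hess_le_at_max]).  The bounds on [phi], with [e * C]
    and [e * D] smaller than [1 / k], give the Hessian version.

    For the Laplacian version, the inequality between the Hessians is traced
    with respect to the metric: a positive definite symmetric matrix [G] is
    congruent to the identity, say [P *m G *m P^T = 1], hence
    [invmx G = P^T *m P], and the trace of [invmx G *m H] is the sum of the
    values of the quadratic form of [H] on the rows of [P]
    ([trace_invmx_mul_le0]). *)

(** * Second derivative test *)

Lemma second_derivative_test_max (R : realType) (f df : R -> R) (r : R) :
  0 < r ->
  (forall t : R, `|t| < r -> is_derive t (1 : R) f (df t)) ->
  derivable df 0 (1 : R) ->
  (forall t, `|t| < r -> f t <= f 0) ->
  df 0 = 0 /\ 'D_(1 : R) df 0 <= 0.
Proof.
move=> r0 fdf ddf fmax.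
have itvr t : t \in `](- r), r[%R -> `|t| < r by rewrite in_itv ltr_norml.
have df0 : df 0 = 0.
  have r00 : `|0 : R| < r by rewrite normr0.
  rewrite -[LHS](@derive_val _ _ _ _ _ _ _ (fdf 0 r00)).
  apply: derive_val; apply: (@derive1_at_max _ _ (- r) r).
  - by rewrite ge0_cp // ltW.
  - by move=> t /itvr /fdf [].
  - by rewrite in_itv /= oppr_lt0 r0.
  - by move=> t /itvr; exact: fmax.
split=> //; rewrite leNgt; apply/negP => L0.
(* If the second derivative were positive, [df] would be positive on a right
   neighbourhood of 0, against the mean value theorem. *)
have : \forall h \near (0 : R)^', 0 < h^-1 *: ((df \o shift 0) (h *: (1 : R)) - df 0).
  exact: cvgr_gt ddf _ L0.
move=> [e /= e0 He].
pose t := Num.min r e / 2.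
have m0 : 0 < Num.min r e by rewrite lt_min r0.
have t0 : 0 < t by rewrite divr_gt0.
have tm : t < Num.min r e by rewrite ltr_pdivrMr // mulr_natr mulr2n ltrDr.
have tr : t < r by apply: lt_le_trans tm _; rewrite ge_min lexx.
have te : t < e by apply: lt_le_trans tm _; rewrite ge_min lexx orbT.
have fd c : c \in `[0, t]%R -> is_derive c (1 : R) f (df c).
  rewrite in_itv /= => /andP[c0 ct].
  by apply: fdf; rewrite ger0_norm // (le_lt_trans ct).
have cf : {within `[0, t], continuous f}.
  by apply: derivable_within_continuous => c /fd [].
have [c] := MVT t0 (fun c cin => fd c (subset_itv_oo_cc cin)) cf.
rewrite in_itv /= => /andP[c0 ct] ftE.
have dfc : 0 < df c.
  have := He c; rewrite /ball_ /= sub0r normrN gtr0_norm //.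
  move=> /(_ (lt_trans ct te) (lt0r_neq0 c0)).
  by rewrite df0 subr0 addr0 /GRing.scale /= mulr1 pmulr_rgt0 // invr_gt0.
have : f t <= f 0 by apply: fmax; rewrite gtr0_norm.
by rewrite -subr_le0 ftE subr0 leNgt mulr_gt0.
Qed.

(** The same test for a function on a normed space, restricted to the line
    through [x] directed by [v]; [v] may be zero. *)
Lemma second_derivative_test_max_dir (R : realType) (V : normedModType R)
    (U : set V) (F dF : V -> R) (x v : V) :
  open U -> U x ->
  (forall y, U y -> is_derive y v F (dF y)) ->
  derivable dF x v ->
  (forall y, U y -> F y <= F x) ->
  dF x = 0 /\ 'D_v dF x <= 0.
Proof.
move=> oU Ux FdF ddF Fmax.
pose l (t : R) := t *: v + x.
have l0 : l 0 = x by rewrite /l scale0r add0r.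
have [r /= r0 Hr] : \forall t \near (0 : R), U (l t).
  have cl : l t @[t --> (0 : R)] --> l 0.
    by apply: cvgD; [apply: cvgZr_tmp; exact: cvg_id | exact: cvg_cst].
  by apply: cl; rewrite l0; exact: open_nbhs_nbhs.
have Ul (t : R) : `|t| < r -> U (l t).
  by move=> tr; apply: Hr; rewrite /ball_ /= sub0r normrN.
have quotE (f : V -> R) (t : R) :
    (fun h : R => h^-1 *: ((f \o l \o shift t) (h *: (1 : R)) - (f \o l) t)) =
    (fun h => h^-1 *: ((f \o shift (l t)) (h *: v) - f (l t))).
  apply/funext => h /=; congr (_ *: (f _ - _)).
  by rewrite /l [h *: 1]mulr1 scalerDl addrA.
have [|||] := @second_derivative_test_max R (F \o l) (dF \o l) r r0.
- move=> t tr; have [dF1 dF2] := FdF _ (Ul _ tr).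
  by apply: DeriveDef; [rewrite /derivable quotE | rewrite /derive quotE].
- by rewrite /derivable quotE l0.
- by move=> t tr /=; rewrite l0; apply: Fmax; exact: Ul.
- rewrite /derive quotE /= l0 => -> h; split=> //.
Qed.

(** * The Hessian in coordinates *)

Section Coordinates.
Context {R : realType} {n : nat}.
Implicit Types (F : 'rV[R]_n -> R) (U : set 'rV[R]_n) (x v w : 'rV[R]_n).

Lemma bilinE (B : 'M[R]_n) v w :
  bilin B v w = \sum_b \sum_a v 0 a * B a b * w 0 b.
Proof.
rewrite /bilin mxE; apply: eq_bigr => b _.
by rewrite !mxE mulr_suml.
Qed.

Lemma bilinB (A B : 'M[R]_n) v w : bilin (A - B) v w = bilin A v w - bilin B v w.
Proof. by rewrite /bilin mulmxBr mulmxBl !mxE. Qed.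

Lemma bilinZ (c : R) (B : 'M[R]_n) v w : bilin (c *: B) v w = c * bilin B v w.
Proof. by rewrite /bilin -scalemxAr -scalemxAl mxE. Qed.

Lemma derive_partials F x v : differentiable F x ->
  'D_v F x = \sum_b v 0 b * partial b F x.
Proof.
move=> dF; rewrite deriveE // [v in LHS]row_sum_delta linear_sum.
by apply: eq_bigr => b _; rewrite linearZ /= /partial deriveE.
Qed.

(** For [F] of class C^2, the second derivative in the direction [v] is the
    quadratic form of the matrix of iterated partial derivatives. *)
Lemma is_derive_derive U F x v : open U -> Ck_on 2 U F -> U x ->
  is_derive x v (fun y => 'D_v F y)
    (\sum_b \sum_a v 0 a * partial a (partial b F) x * v 0 b).
Proof.
move=> oU [dF ddF] Ux.
apply: (@near_eq_is_derive _ _ _ (\sum_(b < n) (v 0 b *: partial b F))).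
  near=> y; rewrite derive_partials; last first.
    by apply: dF; near: y; exact: open_nbhs_nbhs.
  by rewrite fct_sumE.
apply: is_derive_sum => b.
have [db _] := ddF (delta_mx 0 b).
rewrite -mulr_suml -(derive_partials (F := partial b F)); last exact: db.
rewrite mulrC.
apply: is_deriveZ; apply: derivableP; apply: diff_derivable; exact: db.
Unshelve. all: by end_near. Qed.

(** The matrix with entries Gamma^c_{ab} w_c, that is, the part of the
    covariant derivative of a 1-form that depends only on its value [w] at
    [x]. *)
Definition christoffel_mx (G : 'rV[R]_n -> 'M[R]_n) x w : 'M[R]_n :=
  \matrix_(a, b) \sum_(c < n) christoffel G x c a b * w 0 c.

Lemma christoffel_mxZ G x (k : R) w :
  christoffel_mx G x (k *: w) = k *: christoffel_mx G x w.
Proof.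
apply/matrixP => a b; rewrite !mxE mulr_sumr.
by apply: eq_bigr => c _; rewrite mxE mulrCA.
Qed.

Lemma covder_dform U F G x v : open U -> Ck_on 2 U F -> U x ->
  bilin (covder G (dform F) x) v v =
  'D_v (fun y => 'D_v F y) x - bilin (christoffel_mx G x (dform F x)) v v.
Proof.
move=> oU CF Ux.
have [_ ->] := is_derive_derive v oU CF Ux.
rewrite !bilinE -sumrB; apply: eq_bigr => b _.
rewrite -sumrB; apply: eq_bigr => a _; rewrite !mxE mulrBr mulrBl.
congr (_ * partial a _ x * _ - _).
by apply/funext => y; rewrite mxE.
Qed.

(** Comparison of [F] and [c * P] at a maximum of their difference on an open
    set, for an arbitrary matrix-valued [G]. *)
Lemma covder_le_at_max U F P G (c : R) x :
  open U -> Ck_on 2 U F -> Ck_on 2 U P -> U x ->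
  (forall y, U y -> F y - c * P y <= F x - c * P x) ->
  dform F x = c *: dform P x /\
  forall v, bilin (covder G (dform F) x) v v
            <= c * bilin (covder G (dform P) x) v v.
Proof.
move=> oU CF CP Ux hmax.
have [dF _] := CF; have [dP _] := CP.
have test v : 'D_v F x = c * 'D_v P x /\
    'D_v (fun y => 'D_v F y) x <= c * 'D_v (fun y => 'D_v P y) x.
  have [dF2 dF2E] := is_derive_derive v oU CF Ux.
  have [dP2 dP2E] := is_derive_derive v oU CP Ux.
  have [|||/eqP] := @second_derivative_test_max_dir R _ U (F - c *: P)
    ((fun y => 'D_v F y) - c *: (fun y => 'D_v P y)) x v oU Ux.
  - move=> y Uy; apply: is_deriveB; last apply: is_deriveZ.
      by apply: derivableP; apply: diff_derivable; exact: dF.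
    by apply: derivableP; apply: diff_derivable; exact: dP.
  - by apply: derivableB; [exact: dF2 | apply: derivableZ; exact: dP2].
  - exact: hmax.
  - rewrite deriveB; [|exact: dF2|by apply: derivableZ; exact: dP2].
    rewrite deriveZ; last exact: dP2.
    by rewrite subr_eq0 subr_le0 => /eqP.
have dE : dform F x = c *: dform P x.
  by apply/rowP => b; rewrite !mxE; have [] := test (delta_mx 0 b).
split=> // v.
rewrite (covder_dform _ _ oU CF Ux) (covder_dform _ _ oU CP Ux).
rewrite dE christoffel_mxZ bilinZ mulrBr lerD2r.
by have [] := test v.
Qed.

End Coordinates.

(** * Traces against a positive definite matrix *)

(** A real symmetric positive definite matrix is congruent to the identity, by
    induction on the size through the Schur complement. *)
Lemma posdef_congr1 (R : rcfType) (n : nat) (G : 'M[R]_n) :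
  G^T = G -> (forall v : 'rV[R]_n, v != 0 -> 0 < (v *m G *m v^T) 0 0) ->
  exists P : 'M[R]_n, P *m G *m P^T = 1%:M.
Proof.
elim: n G => [|n IHn] G symG posG.
  by exists 0; apply/matrixP => -[].
move: G symG posG; rewrite -[n.+1]/(1 + n)%N => G symG posG.
pose a := ulsubmx G; pose b := ursubmx G; pose d := drsubmx G.
have GE : G = block_mx a b b^T d.
  by rewrite -[in LHS](submxK G) -/a -/b -/d trmx_ursub symG.
have symd : d^T = d by rewrite /d trmx_drsub symG.
pose s := a 0 0.
have aE : a = s%:M by rewrite [a]mx11_scalar.
have s0 : 0 < s.
  have := posG (row_mx 1%:M 0); rewrite row_mx_eq0 oner_eq0 => /(_ isT).
  rewrite GE mul_row_block !mul1mx !mul0mx !addr0 tr_row_mx mul_row_col.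
  by rewrite trmx0 mulmx0 addr0 trmx1 mulmx1.
(* [L] clears the first row and column of [G]; [S] is the Schur complement. *)
pose l : 'M[R]_(n, 1) := - (s^-1 *: b^T).
pose L : 'M[R]_(1 + n) := block_mx 1%:M 0 l 1%:M.
pose S := d + l *m b.
have la : l *m a = - b^T.
  by rewrite aE mul_mx_scalar /l scalerN scalerA divff ?scale1r // gt_eqF.
have al : a *m l^T = - b.
  rewrite aE mul_scalar_mx /l linearN /= linearZ /= trmxK scalerN scalerA.
  by rewrite divff ?scale1r // gt_eqF.
have LG : L *m G = block_mx a b 0 S.
  rewrite GE mulmx_block !mul1mx !mul0mx !addr0 la addNr.
  by rewrite /S addrC.
have LGL : L *m G *m L^T = block_mx a 0 0 S.
  rewrite LG tr_block_mx mulmx_block !trmx1 !trmx0 !mulmx1 !mulmx0 !mul0mx.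
  rewrite !addr0 !add0r; congr block_mx.
  by rewrite al addNr.
have symS : S^T = S.
  rewrite /S linearD /= symd trmx_mul /l linearN linearZ /= trmxK.
  by rewrite mulmxN mulNmx -scalemxAr -scalemxAl.
have posS (v : 'rV[R]_n) : v != 0 -> 0 < (v *m S *m v^T) 0 0.
  move=> v0; have := posG (row_mx 0 v *m L).
  have -> : row_mx 0 v *m L *m G *m (row_mx 0 v *m L)^T =
      row_mx 0 v *m (L *m G *m L^T) *m (row_mx 0 v)^T.
    by rewrite trmx_mul !mulmxA.
  rewrite LGL !mul_row_block tr_row_mx !mul0mx !add0r !mulmx0 mulmx1.
  rewrite mul_row_col mul0mx add0r row_mx_eq0 negb_and v0 orbT.
  exact.
have [Q QS] := IHn S symS posS.
pose r := (Num.sqrt s)^-1.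
have rsr : r * s * r = 1.
  have q0 : Num.sqrt s != 0 by rewrite gt_eqF // sqrtr_gt0.
  by rewrite -[X in _ * X * _](sqr_sqrtr (ltW s0)) expr2 mulrA mulVf ?mul1r ?divff.
pose K : 'M[R]_(1 + n) := block_mx r%:M 0 0 Q.
exists (K *m L).
have -> : K *m L *m G *m (K *m L)^T = K *m (L *m G *m L^T) *m K^T.
  by rewrite trmx_mul !mulmxA.
rewrite LGL mulmx_block tr_block_mx mulmx_block.
rewrite !trmx0 !mulmx0 !mul0mx !addr0 !add0r ?mulmx0 ?mul0mx QS aE.
by rewrite tr_scalar_mx -!scalar_mxM rsr -scalar_mx_block.
Qed.

Lemma trace_invmx_mul_le0 (R : rcfType) (n : nat) (G H : 'M[R]_n) :
  G^T = G -> (forall v : 'rV[R]_n, v != 0 -> 0 < (v *m G *m v^T) 0 0) ->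
  (forall v : 'rV[R]_n, (v *m H *m v^T) 0 0 <= 0) ->
  \tr (invmx G *m H) <= 0.
Proof.
move=> symG posG negH; have [P PGP] := posdef_congr1 symG posG.
have GE : G *m (P^T *m P) = 1%:M.
  by rewrite mulmxA; apply: mulmx1C; rewrite mulmxA.
have GV : invmx G = P^T *m P.
  have [uG _] := mulmx1_unit GE.
  by rewrite -[LHS]mulmx1 -GE mulKmx.
rewrite GV -mulmxA mxtrace_mulC /mxtrace; apply: sumr_le0 => i _.
suff <- : (row i P *m H *m (row i P)^T) 0 0 = (P *m H *m P^T) i i by exact: negH.
by rewrite -row_mul mxE [RHS]mxE; apply: eq_bigr => j _; rewrite !mxE.
Qed.

(** * Existence of maxima *)

Lemma max_of_compact_superlevel (R : realType) (T : topologicalType)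
    (h : T -> R) (K : set T) (p : T) :
  continuous h -> compact K -> (forall x, ~ K x -> h x < h p) ->
  exists q, forall x, h x <= h q.
Proof.
move=> ch cK hK.
have Kp : K p by apply: contrapT => /hK; rewrite ltxx.
have [|q qK hq] := compact_EVT_max (ex_intro _ p Kp) cK (f := h).
  exact: continuous_subspaceT.
exists q => x; have [Kx|/hK/ltW hx] := pselect (K x); first by apply: hq; rewrite inE.
by apply: le_trans hx _; apply: hq; rewrite inE.
Qed.

Section Maximum.
Context {R : realType} {n : nat} (M : smoothManifold R n).
Implicit Types (f phi : M -> R) (p q : M).

(** Near [p], [f] is its coordinate expression composed with a chart. *)
Lemma C2_continuous f : C2_mfd f -> continuous f.
Proof.
move=> Cf p; have [i ip] := mfd_cover p.
have [df _] := Cf i.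
have fE : {near p, in_chart f i \o chart_fun (mfd_chart i) =1 f}.
  near=> q; rewrite /in_chart /= chart_funK //.
  by near: q; apply: open_nbhs_nbhs; split => //; exact: chart_dom_open.
apply: cvg_trans; first exact: near_eq_cvg fE.
rewrite -(nbhs_singleton fE); apply: continuous_comp.
  exact: chart_fun_cts.
by apply: differentiable_continuous; apply: df; exact: chart_funP.
Unshelve. all: by end_near. Qed.

Lemma proper_min phi : continuous phi -> proper_fun phi ->
  exists q, forall x, phi q <= phi x.
Proof.
move=> cphi pphi; have [p _] := mfd_nonempty M.
have [K [cK phiK]] := pphi (phi p).
have [|x nKx|q hq] := @max_of_compact_superlevel _ _ (- phi) K p _ cK.
- by move=> x; exact/continuousN/cphi.
- by rewrite ltrN2; exact: phiK.
- by exists q => x; rewrite -lerN2; exact: hq.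
Qed.

(** Since [f] is bounded above, [f - e * phi] tends to minus infinity outside
    compact sets. *)
Lemma max_sub_proper f phi (e : R) :
  continuous f -> has_ubound (range f) -> continuous phi -> proper_fun phi ->
  0 < e -> exists q, forall x, f x - e * phi x <= f q - e * phi q.
Proof.
move=> cf [B fB] cphi pphi e0; have [p _] := mfd_nonempty M.
have [K [cK phiK]] := pphi (e^-1 * (B - (f p - e * phi p))).
apply: (@max_of_compact_superlevel _ _ (fun x => f x - e * phi x) K p _ cK).
  move=> x; apply: cvgB; first exact: cf.
  by apply: cvgM; [exact: cvg_cst | exact: cphi].
move=> x /phiK; rewrite ltr_pdivrMl // ltrBlDr -ltrBlDl.
by apply: le_lt_trans; rewrite lerB // fB //; exists x.
Qed.

End Maximum.

(** * The gradient and the Hessian at a maximum on the manifold *)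

Section Riemannian.
Context {R : realType} {n : nat} {M : smoothManifold R n}.
Variable g : riemannianMetric M.
Implicit Types (f phi : M -> R) (p q : M).

Lemma coord_at_cod p : chart_cod (mfd_chart (chart_at p)) (coord_at p).
Proof. by apply: chart_funP; rewrite /chart_at; case: cid. Qed.

Lemma chart_inv_coord_at p :
  chart_inv (mfd_chart (chart_at p)) (coord_at p) = p.
Proof. by apply: chart_funK; rewrite /chart_at; case: cid. Qed.

(** At a maximum point of [f - e * phi], the gradients of [f] and [e * phi]
    agree, hence so do their norms, and the Hessian of [f] is at most that of
    [e * phi]. *)
Lemma hess_le_at_max f phi (e : R) q :
  C2_mfd f -> C2_mfd phi -> 0 <= e ->
  (forall x, f x - e * phi x <= f q - e * phi q) ->
  norm_grad g f q = e * norm_grad g phi q /\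
  forall v : tangent q, hess g f v v <= e * hess g phi v v.
Proof.
move=> Cf Cphi e0 hmax; pose c := mfd_chart (chart_at q).
have [|dE hE] := covder_le_at_max (gram g (chart_at q)) (@chart_cod_open _ _ _ c)
  (Cf (chart_at q)) (Cphi (chart_at q)) (coord_at_cod q) (c := e).
  by move=> y _; rewrite /in_chart /= chart_inv_coord_at; exact: hmax.
split; last exact: hE.
rewrite /norm_grad /grad dE -scalemxAl /inner /bilin.
rewrite linearZ /= -!scalemxAl -scalemxAr scalerA mxE -expr2.
by rewrite sqrtrM ?sqr_ge0 // sqrtr_sqr ger0_norm.
Qed.

Lemma laplacian_le_of_hess_le f phi (e : R) q :
  (forall v : tangent q, hess g f v v <= e * hess g phi v v) ->
  laplacian g f q <= e * laplacian g phi q.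
Proof.
move=> hE; rewrite -subr_le0 /laplacian -mxtraceZ scalemxAr -linearB /= -mulmxBr.
have cod := coord_at_cod q.
apply: trace_invmx_mul_le0.
- exact: gram_sym.
- move=> v v0; exact: gram_posdef.
- by move=> v; have := hE v; rewrite /hess -bilinZ -subr_le0 -bilinB.
Qed.

(** The perturbation [f - e * phi] attains its maximum at a point where [f] is
    within [d] of its supremum, for a weight [e] small enough that [e * C] and
    [e * D] are smaller than [d]. *)
Lemma almost_max f phi (C D d : R) :
  C2_mfd f -> has_ubound (range f) -> C2_mfd phi -> proper_fun phi ->
  0 < C -> 0 < D -> 0 < d ->
  exists q e, [/\ 0 < e, e * C < d, e * D < d & sup (range f) - d < f q] /\
    forall x, f x - e * phi x <= f q - e * phi q.
Proof.
move=> Cf fB Cphi pphi C0 D0 d0.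
have cphi := C2_continuous Cphi; have cf := C2_continuous Cf.
have [p0 _] := mfd_nonempty M.
have [_ [p _ <-] fp] : exists2 y, range f y & sup (range f) - d / 2 < y.
  by apply: sup_adherent; [rewrite divr_gt0 | split=> //; exists (f p0), p0].
have [m hm] := proper_min cphi pphi.
(* The weight [e] makes [e * C], [e * D] and [e * (2 * (phi p - phi m))] smaller
   than [d]; the last bound costs at most [d / 2] in the value of [f]. *)
pose s := C + D + 2 * (phi p - phi m) + 1.
have pm : 0 <= phi p - phi m by rewrite subr_ge0.
have s0 : 0 < s by rewrite /s; lra.
pose e := d / s.
have e0 : 0 < e by rewrite divr_gt0.
have es y : y < s -> e * y < d.
  by move=> ys; rewrite /e mulrAC -mulrA gtr_pMr // ltr_pdivrMr // mul1r.
have [q hq] := max_sub_proper cf fB cphi pphi e0.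
exists q, e; split=> //; split=> //; [by apply: es; rewrite /s; lra.. |].
have e2 : e * (2 * (phi p - phi m)) < d by apply: es; rewrite /s; lra.
have em : e * phi m <= e * phi q by rewrite ler_pM2l.
by have := hq p; rewrite mulrCA mulrBr in e2; lra.
Qed.

End Riemannian.

Theorem theorem1p2 (R : realType) (n : nat) (M : smoothManifold R n)
    (g : riemannianMetric M) :
  ((exists (phi : M -> R) (C D : R),
      [/\ C2_mfd phi, 0 < C & 0 < D] /\
      [/\ proper_fun phi,
          (forall p : M, norm_grad g phi p <= C) &
          (forall (p : M) (v : tangent p),
             hess g phi v v <= D * inner g v v)]) ->
   forall f : M -> R, C2_mfd f -> has_ubound (range f) ->
   exists q : nat -> M, forall k : nat, (1 <= k)%N ->
     [/\ sup (range f) - k%:R^-1 < f (q k),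
         norm_grad g f (q k) < k%:R^-1 &
         (forall v : tangent (q k), v != (0 : 'rV[R]_n) ->
            hess g f v v < k%:R^-1 * inner g v v)])
  /\
  ((exists (phi : M -> R) (C D : R),
      [/\ C2_mfd phi, 0 < C & 0 < D] /\
      [/\ proper_fun phi,
          (forall p : M, norm_grad g phi p <= C) &
          (forall p : M, laplacian g phi p <= D)]) ->
   forall f : M -> R, C2_mfd f -> has_ubound (range f) ->
   exists q : nat -> M, forall k : nat, (1 <= k)%N ->
     [/\ sup (range f) - k%:R^-1 < f (q k),
         norm_grad g f (q k) < k%:R^-1 &
         laplacian g f (q k) < k%:R^-1]).
Proof.
have [p0 _] := mfd_nonempty M.
have seq (P : nat -> M -> Prop) :
    (forall k, (1 <= k)%N -> exists q, P k q) ->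
    exists q : nat -> M, forall k, (1 <= k)%N -> P k (q k).
  move=> H; have chosen k : exists q, (1 <= k)%N -> P k q.
    have [/H[q Pq]|nk1] := pselect (1 <= k)%N; first by exists q.
    by exists p0.
  by have [q qP] := choice chosen; exists q.
split=> -[phi [C [D [[Cphi C0 D0] [pphi gphi hphi]]]]] f Cf fB.
- apply: (seq (fun k q => [/\ sup (range f) - k%:R^-1 < f q,
    norm_grad g f q < k%:R^-1 & forall v : tangent q, v != (0 : 'rV[R]_n) ->
      hess g f v v < k%:R^-1 * inner g v v])) => k k1.
  have k0 : 0 < k%:R^-1 :> R by rewrite invr_gt0 ltr0n.
  have [q [e [[e0 eC eD fq] hq]]] := almost_max Cf fB Cphi pphi C0 D0 k0.
  have [gE hE] := hess_le_at_max g Cf Cphi (ltW e0) hq.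
  exists q; split=> //; first by rewrite gE (le_lt_trans _ eC) // ler_pM2l.
  move=> v v0; have v1 : 0 < inner g v v := gram_posdef g (coord_at_cod q) v0.
  apply: le_lt_trans (hE v) _; apply: (@le_lt_trans _ _ (e * (D * inner g v v))).
    by rewrite ler_pM2l.
  by rewrite mulrA ltr_pM2r.
- apply: (seq (fun k q => [/\ sup (range f) - k%:R^-1 < f q,
    norm_grad g f q < k%:R^-1 & laplacian g f q < k%:R^-1])) => k k1.
  have k0 : 0 < k%:R^-1 :> R by rewrite invr_gt0 ltr0n.
  have [q [e [[e0 eC eD fq] hq]]] := almost_max Cf fB Cphi pphi C0 D0 k0.
  have [gE hE] := hess_le_at_max g Cf Cphi (ltW e0) hq.
  exists q; split=> //; first by rewrite gE (le_lt_trans _ eC) // ler_pM2l.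
  apply: le_lt_trans (laplacian_le_of_hess_le hE) _.
  by apply: le_lt_trans eD; rewrite ler_pM2l.
Qed.
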